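(* Suppose that $T$ is irreducible with Perron–Frobenius eigenvalue $\lambda_0>1$. There exist a constant $C>0$ and an integer $K$, depending only on $T$, such that for every $k\ge K$ and every pair of admissible $(k+1)$-words $w_1,w_2$, the Perron–Frobenius eigenvalue $\lambda_1$ of $T_k\langle\{w_1,w_2\}\rangle$ satisfies $|\lambda_1-\lambda_0|\le C\lambda_0^{-k/2}$.
   Context: Let $\mathcal{A}$ be a finite alphabet of $r$ symbols and $T=(T_{x,y})$ an $r\times r$ matrix with entries in $\{0,1\}$; $T$ is irreducible if the directed graph on $\mathcal{A}$ with an edge $x\to y$ iff $T_{y,x}=1$ is strongly connected, and its Perron–Frobenius eigenvalue $\lambda_0$ is its spectral radius (a positive eigenvalue). An admissible $k$-word is a string $a_1\cdots a_k$ of symbols with $T_{a_{i+1},a_i}=1$ for $1\le i\le k-1$. $V_k$ is the complex vector space with basis $\{[w]\}$ indexed by admissible $k$-words, and $T_k:V_k\to V_k$ is linear with $T_k([a_1\cdots a_k])=\sum[a_2\cdots a_kx]$, summed over symbols $x$ with $a_2\cdots a_kx$ admissible. For a word $w$, $\beta w$, $\eta w$ are obtained by deleting the last, resp. first, symbol. For an admissible $(k+1)$-word $w$, $E_w:V_k\to V_k$ is linear with $E_w[\beta w]=[\eta w]$ and $E_w[u]=0$ for all other admissible $k$-words $u$. For a set $\mathcal{C}$ of admissible $(k+1)$-words, $T_k\langle\mathcal{C}\rangle=T_k-\sum_{w\in\mathcal{C}}E_w$; its matrix in the word basis is a non-negative $0/1$ matrix (that of $T_k$ with the $(\eta w,\beta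 w)$ entries set to $0$), i.e. the adjacency matrix of the shift obtained by forbidding the words of $\mathcal{C}$, and its Perron–Frobenius eigenvalue is its spectral radius, which is an eigenvalue. *)

(* Defs.v *)
From mathcomp Require Import all_boot all_order all_algebra all_field.
Set Implicit Arguments.
Unset Strict Implicit.
Unset Printing Implicit Defensive.
Import Order.TTheory GRing.Theory Num.Theory.
Local Open Scope ring_scope.

Definition zero_one {r : nat} (T : 'M[nat]_r) : Prop :=
  forall x y : 'I_r, T x y = 0%N \/ T x y = 1%N.

Definition irreducible_mx {r : nat} (T : 'M[nat]_r) : Prop :=
  forall x y : 'I_r, connect (fun a b : 'I_r => T b a == 1%N) x y.

Definition admissible {r : nat} (T : 'M[nat]_r) (s : seq 'I_r) : bool :=
  sorted (fun a b : 'I_r => T b a == 1%N) s.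

Definition adm {r : nat} (T : 'M[nat]_r) (k : nat) : finType :=
  {t : k.-tuple 'I_r | admissible T t}.

Definition adm_word {r : nat} (T : 'M[nat]_r) (k : nat) (i : 'I_#|adm T k|)
  : seq 'I_r := tval (val (enum_val i)).

Definition beta_w {T : Type} (w : seq T) : seq T := take (size w).-1 w.
Definition eta_w {T : Type} (w : seq T) : seq T := behead w.

(* Matrix of T_k in the word basis: the coefficient of [v] in T_k([u]) is 1
   iff v = a_2 ... a_k x for some symbol x, where u = a_1 ... a_k, i.e. iff
   eta u = beta v (v being an admissible k-word). *)
Definition Tk_entry {r : nat} (T : 'M[nat]_r) (k : nat) (v u : seq 'I_r) : bool :=
  eta_w u == beta_w v.

(* Matrix of T_k<C> for C a set of admissible (k+1)-words given as a list:
   the matrix of T_k with the (eta w, beta w) entries set to 0, i.e.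
   T_k - sum_{w in C} E_w. *)
Definition Tk_forbid {r : nat} (T : 'M[nat]_r) (k : nat) (Cw : seq (seq 'I_r))
  : 'M[algC]_#|adm T k| :=
  \matrix_(i, j)
    (Tk_entry T k (adm_word i) (adm_word j)
     && ~~ has (fun w => (eta_w w == adm_word i) && (beta_w w == adm_word j)) Cw)%:R.

Definition spectral_radius {n : nat} (A : 'M[algC]_n) (rho : algC) : Prop :=
  (exists2 z, eigenvalue A z & `|z| = rho) /\
  (forall z, eigenvalue A z -> `|z| <= rho).

Definition PF_eigenvalue {n : nat} (A : 'M[algC]_n) (lam : algC) : Prop :=
  spectral_radius A lam.

Definition natmx_C {r : nat} (T : 'M[nat]_r) : 'M[algC]_r :=
  map_mx (fun m : nat => m%:R) T.

(* Main.v *)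
(* Let v > 0 be the Perron-Frobenius row vector, v T = lam0 v. Weighting a word
   by v at its last letter gives a positive vector h with
   h T_k<w1,w2> <= lam0 h, hence lam1 <= lam0. For the lower bound, subtract
   from h at a word s the cost M mu^-(k+1-j) (M >= max v) for each prefix of
   length j of w1 or w2 that ends s. The total cost of starting new matches,
   2 M mu^-k, is absorbed by (lam0 - mu) v, so the resulting g satisfies
   g T_k<w1,w2> >= mu g with mu = lam0 - D lam0^(-k/2) (here mu >= sqrt lam0
   gives mu^-k <= lam0^(-k/2)). As g is positive on a one-letter word, it is
   positive on some k-word, and the spectral radius is at least mu. *)
Require Import Defs.
From mathcomp Require Import all_boot all_order all_algebra all_field.
Import Order.TTheory GRing.Theory Num.Theory.
Local Open Scope ring_scope.

(** * Estimates over [algC] and growth of matrix powers *)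

(** Bernoulli's inequality reduces this to the archimedean property. *)
Lemma exprn_eventually_gt (q B : algC) :
  1 < q -> 0 <= B -> exists K, forall k, (K <= k)%N -> B < q ^+ k.
Proof.
move=> q1 B0; have q10 : 0 < q - 1 by rewrite subr_gt0.
have bern k : k%:R * (q - 1) < q ^+ k.
  elim: k => [|k IH]; first by rewrite mul0r expr0 ltr01.
  have qk : 1 <= q ^+ k by rewrite exprn_ege1 // ltW.
  have -> : q ^+ k.+1 = q ^+ k + q ^+ k * (q - 1).
    by rewrite mulrBr mulr1 exprSr addrC subrK.
  rewrite -natr1 mulrDl mul1r ltr_leD // ler_peMl // ltW //.
exists (Num.bound (B / (q - 1))) => k le_k.
apply: le_lt_trans (bern k); rewrite -ler_pdivrMr //.
apply: ltW; apply: lt_le_trans (archi_boundP _) _; first by rewrite divr_ge0 // ltW.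
by rewrite ler_nat.
Qed.

Lemma pos_scale_le (I : finType) (f h : I -> algC) :
  (forall i, 0 < f i) -> (forall i, 0 <= h i) ->
  exists2 e, 0 < e & forall i, e * h i <= f i.
Proof.
move=> f0 h0; have q0 i : 0 <= h i / f i by rewrite divr_ge0 // ltW.
set S := 1 + \sum_i h i / f i; have S0 : 0 < S.
  by rewrite ltr_wpDr // ?ltr01 // sumr_ge0.
exists S^-1 => [|i]; first by rewrite invr_gt0.
rewrite mulrC ler_pdivrMr // mulrC -ler_pdivrMr //.
rewrite /S (bigD1 i) //= addrCA lerDl addr_ge0 ?ler01 // sumr_ge0 //.
Qed.

(** Plays the role of Gelfand's formula. As [x (A - z)] is killed by the remaining factors,
    [x A^(m+1) = x (A - z) A^m + z x A^m] is a recurrence with [|z| <= rho < s], and induction on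
    [zs] applies. *)
Lemma horner_prod_growth (n : nat) (A : 'M[algC]_n.+1) (rho s : algC)
    (zs : seq algC) (x : 'rV_n.+1) :
  0 <= rho -> rho < s -> (forall z, z \in zs -> `|z| <= rho) ->
  x *m horner_mx A (\prod_(z <- zs) ('X - z%:P)) = 0 ->
  exists2 C, 0 <= C & forall m j, `|(x *m A ^+ m) 0 j| <= C * s ^+ m.
Proof.
move=> rho0 rho_s; have s0 : 0 < s by apply: le_lt_trans rho_s.
have d0 : 0 < s - rho by rewrite subr_gt0.
elim: zs x => [|z zs IH] x le_zs.
  rewrite big_nil rmorph1 mulmx1 => ->; exists 0 => // m j.
  by rewrite mul0mx mxE normr0 mul0r.
rewrite big_cons rmorphM rmorphB /= horner_mx_X horner_mx_C mulmxA => xz0.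
case: (IH _ _ xz0) => [u zs_u|C C0 leC]; first by rewrite le_zs ?inE ?zs_u ?orbT.
have zrho : `|z| <= rho by rewrite le_zs ?inE ?eqxx.
(* This [C1] satisfies [C + rho C1 <= s C1]; the sum of the [|x 0 j|] covers exponent 0. *)
pose C1 := C / (s - rho) + \sum_j `|x 0 j|.
have C10 : 0 <= C1 by rewrite addr_ge0 ?sumr_ge0 // divr_ge0 // ltW.
exists C1 => //; elim=> [|m IHm] j.
  rewrite mulmx1 mulr1 /C1 (bigD1 j) //= addrCA lerDl.
  by rewrite addr_ge0 ?sumr_ge0 // divr_ge0 // ltW.
have -> : (x *m A ^+ m.+1) 0 j =
    (x *m (A - z%:M) *m A ^+ m) 0 j + z * (x *m A ^+ m) 0 j.
  by rewrite mulmxBr mul_mx_scalar mulmxBl -mulmxA -scalemxAl exprS !mxE subrK.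
apply: le_trans (ler_normD _ _) _; rewrite normrM.
apply: le_trans (lerD (leC m j) (ler_pM _ _ zrho (IHm j))) _ => //.
rewrite exprS !mulrA -mulrDl ler_wpM2r ?exprn_ge0 ?(ltW s0) //.
rewrite -lerBrDr [rho * _]mulrC -mulrBr.
by rewrite -ler_pdivrMr // lerDl sumr_ge0.
Qed.

(* Half of the Collatz-Wielandt characterisation of the spectral radius. *)
Lemma subinvariant_le_spectral_radius (n : nat) (A : 'M[algC]_n)
    (rho mu : algC) (x : 'rV_n) (j : 'I_n) :
  (forall i l, 0 <= A i l) -> spectral_radius A rho -> 0 <= mu -> 0 < x 0 j ->
  (forall l, mu * x 0 l <= (x *m A) 0 l) -> mu <= rho.
Proof.
case: n A x j => [|n] A x j; first by case: j.
move=> A0 [[z0 _ z0rho] rhoP] mu0 xj xA.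
have rho0 : 0 <= rho by rewrite -z0rho.
rewrite real_leNgt ?ger0_real //; apply/negP=> rho_mu.
(* By Cayley-Hamilton the entries of [x A^m] are at most [C s^m], while iteration bounds entry [j]
   below by [mu^m x_j]; these clash for large [m]. *)
pose s := (rho + mu) / 2.
have [rho_s s_mu] : rho < s /\ s < mu.
  by have [] := midf_lt rho_mu.
have s0 : 0 < s by apply: le_lt_trans rho_s.
have [zs def_p] := closed_field_poly_normal (char_poly A).
have [||C C0 leC] := @horner_prod_growth n A rho s zs x rho0 rho_s.
- move=> z zs_z; apply: rhoP; rewrite eigenvalue_root_char def_p.
  rewrite (monicP (char_poly_monic A)) scale1r root_prod_XsubC //.
- have := Cayley_Hamilton A; rewrite def_p (monicP (char_poly_monic A)) scale1r.
  by move=> ->; rewrite mulmx0.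
have xAm m l : mu ^+ m * x 0 l <= (x *m A ^+ m) 0 l.
  elim: m l => [|m IH] l; first by rewrite mulmx1 mul1r.
  rewrite exprSr -mulrA exprSr mulmxA.
  apply: le_trans (ler_wpM2l (exprn_ge0 m mu0) (xA l)) _.
  rewrite !mxE mulr_sumr; apply: ler_sum => i _.
  by rewrite mulrA ler_wpM2r.
have [||K ltK] := @exprn_eventually_gt (mu / s) (C / x 0 j).
- by rewrite ltr_pdivlMr ?mul1r.
- by rewrite divr_ge0 // ltW.
have := ltK K (leqnn K); rewrite expr_div_n ltr_pdivrMr // mulrAC.
rewrite ltr_pdivlMr ?exprn_gt0 // => CK.
have xAj0 : 0 <= (x *m A ^+ K) 0 j.
  by apply: le_trans (xAm K j); rewrite mulr_ge0 ?exprn_ge0 // ltW.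
suff: false by [].
rewrite -(lt_irreflexive (C * s ^+ K)); apply: lt_le_trans CK _.
by apply: le_trans (xAm K j) _; rewrite -(ger0_norm xAj0).
Qed.


(** * Perron eigenvectors and super-invariant vectors of non-negative matrices *)

Lemma mulmx_ge0 (m n : nat) (x : 'rV[algC]_m) (A : 'M_(m, n)) :
  (forall i, 0 <= x 0 i) -> (forall i l, 0 <= A i l) ->
  forall l, 0 <= (x *m A) 0 l.
Proof. by move=> x0 A0 l; rewrite mxE sumr_ge0 // => i _; rewrite mulr_ge0. Qed.

(** Each factor [1 + A] either waits or moves along an edge, so [(1 + A)^m] carries positivity from
    the end of a path of length at most [m] back to its start. *)
Lemma mulmx_path_gt0 (n : nat) (A : 'M[algC]_n.+1) (d : 'rV_n.+1) (m : nat) x p :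
  (forall i l, 0 <= A i l) -> (forall i, 0 <= d 0 i) ->
  path (fun a b => A b a != 0) x p -> 0 < d 0 (last x p) -> (size p <= m)%N ->
  0 < (d *m (1 + A) ^+ m) 0 x.
Proof.
move=> A0 d0.
have P0 i l : 0 <= (1 + A) i l by rewrite !mxE addr_ge0 ?ler0n.
have dm0 k l : 0 <= (d *m (1 + A) ^+ k) 0 l.
  elim: k l => [|k IH] l; first by rewrite mulmx1.
  by rewrite exprSr mulmxA mulmx_ge0.
elim: m x p => [|m IH] x [|y p] //= ep dp le_p; first by rewrite mulmx1.
  rewrite exprSr mulmxA mulmxDr mulmx1 mxE ltr_wpDr ?mulmx_ge0 //.
  exact: (IH x [::]).
case/andP: ep => Ayx ep.
rewrite exprSr mulmxA mulmxDr mulmx1 mxE ltr_wpDl // mxE (bigD1 y) //=.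
rewrite ltr_wpDr ?sumr_ge0 // => [l _|]; first by rewrite mulr_ge0.
by rewrite mulr_gt0 ?(IH y p) // lt0r Ayx A0.
Qed.

(* For an eigenvector [x] of modulus [rho], [|x|] is an eigenvector: a nonzero
   defect [|x| A - rho |x|], made strictly positive by a power of [1 + A],
   would push the spectral radius above [rho]. *)
Lemma perron_frobenius_vector (n : nat) (A : 'M[algC]_n) (rho : algC) :
  (forall i l, 0 <= A i l) ->
  (forall x y, connect (fun a b => A b a != 0) x y) ->
  spectral_radius A rho ->
  exists2 v : 'rV_n, forall i, 0 < v 0 i & v *m A = rho *: v.
Proof.
case: n A => [|n] A A0 irrA specA.
  case: specA => [[z /eigenvalueP[v _ /eqP[]]]].
  by apply/rowP => -[].
have [[z /eigenvalueP[x xA x_n0] z_rho] _] := specA.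
have rho0 : 0 <= rho by rewrite -z_rho.
pose v : 'rV_n.+1 := \row_i `|x 0 i|.
have v0 i : 0 <= v 0 i by rewrite mxE.
have [a va] : exists a, 0 < v 0 a.
  by case/rV0Pn: x_n0 => a xa; exists a; rewrite mxE normr_gt0.
pose d := v *m A - rho *: v.
(* Triangle inequality: [|x| A >= |x A| = rho |x|]. *)
have d0 i : 0 <= d 0 i.
  rewrite !mxE subr_ge0 -z_rho -normrM.
  have -> : z * x 0 i = (x *m A) 0 i by rewrite xA mxE.
  rewrite mxE (le_trans (ler_norm_sum _ _ _)) // ler_sum // => l _.
  by rewrite normrM mxE (ger0_norm (A0 _ _)).
pose P := 1 + A.
have posP (u : 'rV_n.+1) b : (forall i, 0 <= u 0 i) -> 0 < u 0 b ->
    forall i, 0 < (u *m P ^+ n) 0 i.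
  move=> u0 ub i; have /connectP[p ep def_b] := irrA i b.
  (* Without repeated vertices, a path among [n.+1] indices has at most [n] edges. *)
  move: ub; rewrite def_b; case/shortenP: ep => p' ep' Up' _ ub.
  apply: mulmx_path_gt0 ep' ub _ => //.
  by have := max_card (mem (i :: p')); rewrite card_ord (card_uniqP Up').
have Pn_comm : P ^+ n *m A = A *m P ^+ n.
  by apply/esym/commrX/commrD; rewrite /GRing.comm ?mulr1 ?mul1r.
have dP : d *m P ^+ n = v *m P ^+ n *m A - rho *: (v *m P ^+ n).
  by rewrite mulmxBl -scalemxAl -!mulmxA Pn_comm.
have [d_eq0|/rV0Pn[b db]] := eqVneq d 0; last first.
  have db0 : 0 < d 0 b by rewrite lt0r db d0.
  have [e e0 le_e] := @pos_scale_le _ (fun i => (d *m P ^+ n) 0 i)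
    (fun i => (v *m P ^+ n) 0 i) (posP d b d0 db0) (fun i => ltW (posP v a v0 va i)).
  have := subinvariant_le_spectral_radius _ A rho (rho + e) (v *m P ^+ n) a A0 specA.
  rewrite addr_ge0 ?(ltW e0) // gerDl (posP v a v0 va a) => /(_ isT isT).
  suff rhoe l : (rho + e) * (v *m P ^+ n) 0 l <= (v *m P ^+ n *m A) 0 l.
    by move/(_ rhoe)=> e_le0; have := lt_le_trans e0 e_le0; rewrite ltxx.
  have sub_entry (u w : 'rV[algC]_n.+1) : (u - rho *: w) 0 l = u 0 l - rho * w 0 l.
    by rewrite !mxE.
  by have := le_e l; rewrite dP sub_entry lerBrDl mulrDl.
exists (v *m P ^+ n); first exact: posP va.
by apply/eqP; rewrite -subr_eq0 -dP d_eq0 mul0mx.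
Qed.

(** Evaluate [x A = z x] at an index maximising [|x_i| / h_i], where [|x|] touches its least
    majorant proportional to [h]. *)
Lemma superinvariant_ge_eigenvalue (n : nat) (A : 'M[algC]_n) (lam : algC)
    (h : 'rV_n) (z : algC) :
  (forall i l, 0 <= A i l) -> (forall i, 0 < h 0 i) ->
  (forall l, (h *m A) 0 l <= lam * h 0 l) -> eigenvalue A z -> `|z| <= lam.
Proof.
move=> A0 h0 hA /eigenvalueP[x xA /rV0Pn[a xa]].
pose q i := `|x 0 i| / h 0 i.
have q_real i : predT i -> q i \is Num.real.
  by move=> _; rewrite ger0_real // divr_ge0 // ltW.
have [b _ max_b] := real_arg_maxP (i0 := a) isT q_real.
have xb : 0 < `|x 0 b|.
  have: q a <= q b by apply: max_b.
  have hb : 0 < (h 0 b)^-1 by rewrite invr_gt0.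
  by rewrite -(pmulr_lgt0 _ hb); apply: lt_le_trans; rewrite divr_gt0 ?normr_gt0.
have lex l : `|x 0 l| <= q b * h 0 l by rewrite -ler_pdivrMr //; apply: max_b.
have qb0 : 0 <= q b by rewrite divr_ge0 // ltW.
rewrite -(ler_pM2r xb) -normrM.
have -> : z * x 0 b = (x *m A) 0 b by rewrite xA mxE.
apply: (@le_trans _ _ (q b * (h *m A) 0 b)); last first.
  apply: le_trans (ler_wpM2l qb0 (hA b)) _.
  by rewrite mulrCA /q divfK // gt_eqF.
rewrite !mxE (le_trans (ler_norm_sum _ _ _)) // mulr_sumr ler_sum // => l _.
by rewrite normrM (ger0_norm (A0 _ _)) mulrA ler_wpM2r.
Qed.

(** * Admissible words and the action of [Tk_forbid] on functions of words *)

Lemma suffix_behead (A : eqType) (t : seq A) a u :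
  (size t <= size u)%N -> suffix t (a :: u) = suffix t u.
Proof. by move=> le_tu; rewrite !suffixE /= subSn. Qed.

Lemma size_adm_word (r : nat) (T : 'M[nat]_r) (k : nat) (i : 'I_#|adm T k|) :
  size (adm_word i) = k.
Proof. by rewrite /adm_word size_tuple. Qed.

Lemma admissible_adm_word (r : nat) (T : 'M[nat]_r) (k : nat) (i : 'I_#|adm T k|) :
  admissible T (adm_word i).
Proof. exact: (valP (enum_val i)). Qed.

Lemma adm_word_inj (r : nat) (T : 'M[nat]_r) (k : nat) :
  injective (@adm_word r T k).
Proof. by move=> i j /val_inj/val_inj/enum_val_inj. Qed.

Lemma adm_word_surj (r : nat) (T : 'M[nat]_r) (k : nat) (s : seq 'I_r) :
  size s = k -> admissible T s -> exists i : 'I_#|adm T k|, adm_word i = s.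
Proof.
move=> /eqP sz_s adm_s.
by exists (enum_rank (exist _ (Tuple sz_s) adm_s : adm T k)); rewrite /adm_word enum_rankK.
Qed.

Lemma beta_w_rcons (A : Type) (s : seq A) y : beta_w (rcons s y) = s.
Proof. by rewrite /beta_w size_rcons -cats1 take_size_cat. Qed.

Lemma admissible_rcons (r : nat) (T : 'M[nat]_r) x p y :
  admissible T (x :: p) ->
  admissible T (rcons (x :: p) y) = (T y (last x p) == 1%N).
Proof. by rewrite /admissible /= rcons_path => ->. Qed.

Lemma eta_beta_eq_rcons (A : eqType) (w s : seq A) y : (0 < size s)%N ->
  (eta_w w == behead (rcons s y)) && (beta_w w == s) = (w == rcons s y).
Proof.
case: s => // x p _; apply/andP/eqP => [[/eqP eta_wE /eqP]|->]; last first.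
  by rewrite beta_w_rcons !eqxx.
case/lastP: w eta_wE => [|u z] //; rewrite beta_w_rcons => eta_u def_u.
by move: eta_u; rewrite def_u /= => /rcons_inj[->].
Qed.

(** The rows that contribute to column [j] append a letter to [adm_word j] and drop the first one;
    they are reindexed by the appended letter. *)
Lemma mulmx_Tk_forbid (r : nat) (T : 'M[nat]_r) (k : nat) (Cw : seq (seq 'I_r))
    (phi : seq 'I_r -> algC) (j : 'I_#|adm T k|) : (1 < k)%N ->
  ((\row_i phi (adm_word i)) *m Tk_forbid T k Cw) 0 j =
  \sum_(y | admissible T (rcons (adm_word j) y) && (rcons (adm_word j) y \notin Cw))
     phi (behead (rcons (adm_word j) y)).
Proof.
move=> k1; rewrite mxE.
under eq_bigr do rewrite !mxE mulr_natr mulrb.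
rewrite -big_mkcond /=.
have := size_adm_word r T k j; have := admissible_adm_word r T k j.
set s := adm_word j; case def_s: s => [|x p] adm_s /= sz_s; first by rewrite -sz_s in k1.
have p0 : (0 < size p)%N by rewrite -ltnS sz_s.
pose word y : seq 'I_r := rcons p y.
(* The default [j] is harmless: the summation conditions force [adm_word (ext y) = word y],
   impossible when [word y] is not admissible. *)
pose ext y := odflt j [pick i | adm_word i == word y :> seq 'I_r].
have forbE (i : 'I_#|adm T k|) y : adm_word i = word y ->
    has (fun w => (eta_w w == adm_word i) && (beta_w w == x :: p)) Cw =
    (rcons (x :: p) y \in Cw).
  move=> ->; rewrite -has_pred1; apply: eq_has => w /=.
  exact: (eta_beta_eq_rcons _ w (x :: p) y).
have wordE (i : 'I_#|adm T k|) : p == beta_w (adm_word i) -> adm_word i = word (last x (adm_word i)).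
  have := size_adm_word r T k i; case/lastP: (adm_word i) => [/esym k0|u z _].
    by rewrite k0 in k1.
  by rewrite beta_w_rcons last_rcons => /eqP <-.
rewrite (reindex_onto ext (fun i => last x (adm_word i))) /Tk_entry /=; last first.
  move=> i /andP[/wordE Ei _]; rewrite /ext; case: pickP => [i' /eqP Ei'|/(_ i)].
    by apply: (@adm_word_inj _ T k); rewrite Ei' -Ei.
  by rewrite -Ei eqxx.
(* Here [1 < k] matters: since [p] is nonempty, the transition into [y] is visible in [word y]. *)
have ext_adm y (i : 'I_#|adm T k|) : adm_word i = word y -> admissible T (x :: rcons p y).
  move=> Ei; have := admissible_adm_word r T k i; rewrite Ei.
  by case: p p0 adm_s {def_s sz_s forbE wordE ext} @word Ei => //= a p _ /andP[-> _].
have word_ext y : admissible T (x :: rcons p y) -> adm_word (ext y) = word y.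
  move=> adm_y; rewrite /ext; case: pickP => [i' /eqP //|none_i].
  have [||i Ei] := @adm_word_surj _ T k (word y).
  - by rewrite size_rcons -sz_s.
  - by move: adm_y; rewrite /admissible /= => /path_sorted.
  by have := none_i i; rewrite Ei eqxx.
apply: eq_big => [y|y] /=; last first.
  by case/andP=> /andP[/wordE Ei _] /eqP lastE; rewrite Ei lastE.
apply/idP/idP => [/andP[/andP[/wordE Ei forb] /eqP lastE]|/andP[adm_y forb]].
  rewrite lastE in Ei; rewrite (forbE _ _ Ei) in forb.
  by apply/andP; split; first exact: ext_adm Ei.
have Ei := word_ext y adm_y.
by rewrite (forbE _ _ Ei) forb Ei beta_w_rcons last_rcons !eqxx.
Qed.

(** * Perron weights and the cost of partial matches *)

Definition last_weight (r : nat) (v : 'rV[algC]_r) (s : seq 'I_r) : algC :=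
  if s is x :: p then v 0 (last x p) else 0.

Lemma sum_last_weight (r : nat) (T : 'M[nat]_r) (v : 'rV[algC]_r) lam x p :
  zero_one T -> v *m natmx_C T = lam *: v -> admissible T (x :: p) ->
  \sum_(y | admissible T (rcons (x :: p) y)) last_weight r v (rcons (x :: p) y) =
  lam * v 0 (last x p).
Proof.
move=> T01 vT adm_s.
have -> : lam * v 0 (last x p) = (v *m natmx_C T) 0 (last x p) by rewrite vT mxE.
rewrite mxE big_mkcond; apply: eq_bigr => y _.
rewrite admissible_rcons //= last_rcons mxE.
by case: (T01 y (last x p)) => ->; rewrite ?mulr0 ?mulr1.
Qed.

(* Each proper prefix of [w] that ends [s] is charged geometrically: reading
   one more letter either kills the match or lengthens it, at the cost [mu]. *)
Definition match_cost (A : eqType) (M mu : algC) (k : nat) (w s : seq A) : algC :=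
  \sum_(i < k) M / mu ^+ (k - i) * (suffix (take i.+1 w) s)%:R.

Lemma match_cost_ge0 (A : eqType) (M mu : algC) (k : nat) (w s : seq A) :
  0 <= M -> 0 < mu -> 0 <= match_cost A M mu k w s.
Proof.
move=> M0 mu0; apply: sumr_ge0 => i _.
by rewrite mulr_ge0 ?ler0n // divr_ge0 // exprn_ge0 // ltW.
Qed.

Lemma match_cost_nil (A : eqType) (M mu : algC) (k : nat) (w : seq A) :
  (0 < size w)%N -> match_cost A M mu k w [::] = 0.
Proof.
move=> w0; apply: big1 => i _; case: w w0 => // a w _.
by rewrite suffixs0 mulr0.
Qed.

(** Charged prefixes have length at most [k], so they cannot see the first of [k.+1] letters. *)
Lemma match_cost_behead (A : eqType) (M mu : algC) (k : nat) (w s : seq A) :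
  size s = k.+1 -> match_cost A M mu k w (behead s) = match_cost A M mu k w s.
Proof.
case: s => // a u [sz_u]; apply: eq_bigr => i _.
by rewrite suffix_behead // sz_u size_take_min geq_min ltn_ord.
Qed.

(** A completed match counts as the prefix of length [k.+1], at cost [M]. A nonempty prefix ends
    [rcons s y] only if it continues, by the right [y], a shorter one ending [s]; the empty prefix
    gives the starting cost [M / mu ^+ k]. *)
Lemma sum_match_cost_rcons (A : finType) (P : pred A) (M mu : algC) (k : nat)
    (w s : seq A) : 0 <= M -> 0 < mu -> size w = k.+1 ->
  \sum_(y | P y) (match_cost A M mu k w (rcons s y) + M * (w == rcons s y)%:R)
  <= M / mu ^+ k + mu * match_cost A M mu k w s.
Proof.
move=> M0 mu0 sz_w.
have c0 (i : nat) : 0 <= M / mu ^+ (k - i) by rewrite divr_ge0 // exprn_ge0 // ltW.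
apply: (@le_trans _ _ (\sum_(y : A) \sum_(i < k.+1)
    M / mu ^+ (k - i) * (suffix (take i.+1 w) (rcons s y))%:R)).
  rewrite big_mkcond; apply: ler_sum => y _; case: (P y); last first.
    by apply: sumr_ge0 => i _; rewrite mulr_ge0 ?ler0n.
  rewrite big_ord_recr /= lerD2l subnn expr0 divr1 ler_wpM2l // ler_nat.
  by rewrite take_oversize ?sz_w //; case: eqP => // ->; rewrite suffix_refl.
rewrite exchange_big /=.
have w0 : A by case: w sz_w.
have step (i : 'I_k.+1) : \sum_(y : A)
      M / mu ^+ (k - i) * (suffix (take i.+1 w) (rcons s y))%:R =
    M / mu ^+ (k - i) * (suffix (take i w) s)%:R.
  rewrite -mulr_sumr; congr (_ * _).
  under eq_bigr => y _ do rewrite (take_nth w0) ?sz_w // suffix_rcons.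
  rewrite (bigD1 (nth w0 w i)) //= eqxx big1 ?addr0 // => y.
  by rewrite eq_sym => /negPf ->.
under eq_bigr do rewrite step.
(* For the nonempty prefixes the index shift leaves exactly one factor [mu]. *)
rewrite big_ord_recl /= subn0 take0 suffix0s mulr1 lerD2l.
rewrite mulr_sumr; apply: ler_sum => i _.
rewrite mulrA le_eqVlt; apply/orP; left; apply/eqP; congr (_ * _).
rewrite /bump /= add1n mulrCA; congr (_ * _).
rewrite subnS; have : (0 < k - i)%N by rewrite subn_gt0.
case: (k - i)%N => // m _ /=.
by rewrite exprS invfM mulrA divff ?mul1r // gt_eqF.
Qed.

(** * The potential and the lower bound on the spectral radius *)

Definition potential (r : nat) (v : 'rV[algC]_r) (M mu : algC) (k : nat)
    (Cw : seq (seq 'I_r)) (s : seq 'I_r) : algC :=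
  last_weight r v s - \sum_(w <- Cw) match_cost _ M mu k w s.

Section Potential.
Variables (r : nat) (T : 'M[nat]_r) (lam M mu : algC) (v : 'rV[algC]_r).
Variables (k : nat) (Cw : seq (seq 'I_r)).
Hypotheses (T01 : zero_one T) (vT : v *m natmx_C T = lam *: v).
Hypotheses (vM : forall x, v 0 x <= M) (M0 : 0 <= M) (mu0 : 0 < mu).
Hypothesis sz_Cw : forall w, w \in Cw -> size w = k.+1.
Hypothesis small_cost : forall x, (size Cw)%:R * (M / mu ^+ k) <= (lam - mu) * v 0 x.

Local Notation g := (potential r v M mu k Cw).

Let cost_ge0 s : 0 <= \sum_(w <- Cw) match_cost _ M mu k w s.
Proof. by apply: sumr_ge0 => w _; apply: match_cost_ge0. Qed.

Let sum_cost_le (P : pred 'I_r) s :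
  \sum_(y | P y) \sum_(w <- Cw)
     (match_cost _ M mu k w (rcons s y) + M * (w == rcons s y)%:R) <=
  (size Cw)%:R * (M / mu ^+ k) + mu * \sum_(w <- Cw) match_cost _ M mu k w s.
Proof.
rewrite exchange_big /= mulr_sumr.
have -> : (size Cw)%:R * (M / mu ^+ k) = \sum_(w <- Cw) M / mu ^+ k.
  by rewrite big_const_seq count_predT iter_addr_0 mulr_natl.
rewrite -big_split /= !big_seq; apply: ler_sum => w /sz_Cw sz_w.
exact: sum_match_cost_rcons.
Qed.

Lemma potential_step x p : admissible T (x :: p) ->
  mu * g (x :: p) <=
  \sum_(y | admissible T (rcons (x :: p) y) && (rcons (x :: p) y \notin Cw))
     g (rcons (x :: p) y).
Proof.
move=> adm_s; set s := x :: p.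
apply: (@le_trans _ _ (\sum_(y | admissible T (rcons s y))
   (last_weight r v (rcons s y) - \sum_(w <- Cw)
     (match_cost _ M mu k w (rcons s y) + M * (w == rcons s y)%:R)))).
  rewrite sumrB (sum_last_weight _ _ _ lam) //.
  apply: le_trans (lerB (lexx _) (sum_cost_le _ _)).
  rewrite /potential mulrBr opprD addrA lerB // lerBrDr addrC -lerBrDr -mulrBl.
  exact: small_cost.
rewrite big_mkcondr; apply: ler_sum => y _.
rewrite big_split /= -mulr_sumr opprD addrA.
case: ifP => [_|/negbFE in_y].
  by rewrite gerBl mulr_ge0 // sumr_ge0.
(* A repeated word in [Cw], as when [w1 = w2], only raises the count. *)
have count_ge1 : 1 <= \sum_(w <- Cw) (w == rcons s y)%:R :> algC.
  rewrite (big_rem _ in_y) /= eqxx lerDl sumr_ge0 //.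
rewrite subr_le0; apply: (@le_trans _ _ M).
  by apply: le_trans (vM (last x (rcons p y))); rewrite gerBl.
by rewrite -[leLHS]mulr1 ler_wpM2l.
Qed.

(** Appended to the empty word, where no match is in progress, a letter pays at most the starting
    costs. *)
Lemma potential_letter_gt0 x :
  (size Cw)%:R * (M / mu ^+ k) < v 0 x -> 0 < g [:: x].
Proof.
move=> small_x; rewrite subr_gt0; apply: le_lt_trans small_x.
have cost_nil : \sum_(w <- Cw) match_cost _ M mu k w [::] = 0.
  by rewrite big_seq big1 // => w /sz_Cw sz_w; rewrite match_cost_nil ?sz_w.
have := sum_cost_le (pred1 x) [::]; rewrite big_pred1_eq cost_nil mulr0 addr0.
apply: le_trans; apply: ler_sum => w _.
by rewrite lerDl mulr_ge0 ?ler0n.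
Qed.

(** By [potential_step], a word of positive potential has an extension of positive potential. *)
Lemma potential_word_gt0 x n :
  (size Cw)%:R * (M / mu ^+ k) < v 0 x ->
  exists s, [/\ size s = n.+1, admissible T s & 0 < g s].
Proof.
move=> small_x; elim: n => [|n [[|y p] [// sz_s adm_s g_s]]].
  by exists [:: x]; rewrite potential_letter_gt0.
have sum_gt0 := lt_le_trans (mulr_gt0 mu0 g_s) (potential_step _ _ adm_s).
have [/existsP[z /andP[adm_z gz]]|/existsPn no_z] :=
    boolP [exists z, admissible T (rcons (y :: p) z) && (0 < g (rcons (y :: p) z))].
  by exists (rcons (y :: p) z); rewrite size_rcons sz_s.
suff le0 : \sum_(z | admissible T (rcons (y :: p) z) && (rcons (y :: p) z \notin Cw))
    g (rcons (y :: p) z) <= 0 by have := lt_le_trans sum_gt0 le0; rewrite ltxx.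
(* The order on [algC] is partial, so [g] must be shown real here. *)
apply: sumr_le0 => z /andP[adm_z _]; rewrite real_leNgt ?real0 //.
  by have := no_z z; rewrite adm_z.
apply: rpredB; last exact: ger0_real.
by rewrite /= (ler_real (vM _)) ger0_real.
Qed.

Lemma potential_behead s :
  size s = k.+1 -> (0 < k)%N -> g (behead s) = g s.
Proof.
move=> sz_s k0; rewrite /potential; congr (_ - _).
  by case: s sz_s => [|a [|b u]] //= [k_eq]; rewrite -k_eq in k0.
by apply: eq_bigr => w _; rewrite match_cost_behead.
Qed.

Lemma Tk_forbid_spectral_radius_ge x rho : (1 < k)%N ->
  (size Cw)%:R * (M / mu ^+ k) < v 0 x ->
  spectral_radius (Tk_forbid T k Cw) rho -> mu <= rho.
Proof.
move=> k1 small_x spec_rho.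
have [s [sz_s adm_s g_s]] := potential_word_gt0 x k.-1 small_x.
rewrite prednK ?(ltnW k1) // in sz_s.
have [j def_s] := @adm_word_surj _ T _ _ sz_s adm_s.
apply: (@subinvariant_le_spectral_radius _ _ _ _ (\row_i g (adm_word i)) j _ spec_rho).
- by move=> i l; rewrite mxE ler0n.
- exact: ltW.
- by rewrite mxE def_s.
move=> l; rewrite mulmx_Tk_forbid // mxE.
have := size_adm_word r T k l; have := admissible_adm_word r T k l.
case def_l: (adm_word l) => [|y p] adm_l sz_l; first by rewrite -sz_l in k1.
apply: le_trans (potential_step _ _ adm_l) _; apply: ler_sum => z _.
by rewrite potential_behead ?size_rcons ?sz_l // ltnW.
Qed.

End Potential.

(** * The upper bound and the choice of constants *)

(** Forbidding words only removes non-negative terms from [sum_last_weight], so the Perron weights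
    are super-invariant. *)
Lemma Tk_forbid_eigenvalue_le (r : nat) (T : 'M[nat]_r) (lam : algC)
    (v : 'rV[algC]_r) (k : nat) (Cw : seq (seq 'I_r)) (z : algC) :
  zero_one T -> v *m natmx_C T = lam *: v -> (forall x, 0 < v 0 x) -> (1 < k)%N ->
  eigenvalue (Tk_forbid T k Cw) z -> `|z| <= lam.
Proof.
move=> T01 vT v0 k1.
have word_cons (i : 'I_#|adm T k|) : exists x p, adm_word i = x :: p.
  have := size_adm_word r T k i; case: (adm_word i) => [k0|x p _]; last by exists x, p.
  by rewrite -k0 in k1.
apply: (superinvariant_ge_eigenvalue _ _ _ (\row_i last_weight r v (adm_word i))).
- by move=> i l; rewrite mxE ler0n.
- by move=> i; rewrite mxE; have [x [p ->]] := word_cons i; apply: v0.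
move=> l; rewrite mulmx_Tk_forbid // mxE.
have := size_adm_word r T k l; have := admissible_adm_word r T k l.
have [x [p ->]] := word_cons l => adm_l sz_l.
rewrite -(sum_last_weight _ _ _ _ _ _ T01 vT adm_l) big_mkcondr.
apply: ler_sum => y _ /=; case: p adm_l sz_l => [_ k1'|a p _ _].
  by rewrite -k1' in k1.
by case: ifP => // _; apply: ltW; apply: v0.
Qed.

Theorem theorem1p6 (r : nat) (T : 'M[nat]_r) (lam0 : algC) :
  zero_one T -> irreducible_mx T ->
  PF_eigenvalue (natmx_C T) lam0 -> 1 < lam0 ->
  exists (C : algC) (K : nat), 0 < C /\
    forall (k : nat), (K <= k)%N ->
    forall (w1 w2 : (k.+1).-tuple 'I_r),
      admissible T w1 -> admissible T w2 ->
      forall lam1 : algC,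
        PF_eigenvalue (Tk_forbid T k [:: tval w1; tval w2]) lam1 ->
        `|lam1 - lam0| <= C * (sqrtC lam0 ^+ k)^-1.
Proof.
move=> T01 irrT specT lam0_gt1.
have T0 x y : 0 <= natmx_C T x y by rewrite mxE ler0n.
have connT x y : connect (fun a b => natmx_C T b a != 0) x y.
  apply: (connect_sub _ (irrT x y)) => a b /eqP Tba; apply: connect1.
  by rewrite /= mxE Tba oner_neq0.
have [v v0 vT] := perron_frobenius_vector _ _ _ T0 connT specT.
have lam0_ge0 : 0 <= lam0 by apply: ltW; apply: lt_trans lam0_gt1.
set q := sqrtC lam0.
have q1 : 1 < q by rewrite -[1]sqrtC1 ltr_sqrtC ?qualifE /= ?ler01.
have q0 : 0 < q by apply: lt_trans q1.
have q_lam : q < lam0.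
  by rewrite -[ltRHS]sqrtCK -/q expr2 ltr_pMl.
pose M := 1 + \sum_x v 0 x.
have sumv0 : 0 <= \sum_x v 0 x by apply: sumr_ge0 => x _; apply: ltW.
have M0 : 0 < M by rewrite ltr_wpDr ?ltr01.
have vM x : v 0 x <= M.
  rewrite /M (bigD1 x) //= addrCA lerDl addr_ge0 ?ler01 //.
  by apply: sumr_ge0 => y _; apply: ltW.
have [m m0 mv] := @pos_scale_le _ (fun x => v 0 x) (fun=> 1) v0 (fun=> ler01).
(* With [m] a lower bound for [v], this [D] makes the starting cost [2 M / q ^+ k] equal to
   [(lam0 - mu) m]. *)
have [D D0 Dm] : exists2 D, 0 < D & D * m = 2 * M.
  exists (2 * M / m); last by rewrite divfK // gt_eqF.
  by rewrite divr_gt0 // mulr_gt0 // ltr0n.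
have gap0 : 0 < lam0 - q by rewrite subr_gt0.
(* The two summands serve separate needs: [D / q ^+ k < lam0 - q] gives [q <= mu], and
   [D / q ^+ k < 1] makes the potential of a letter positive. *)
have [|K ltK] := exprn_eventually_gt q (D / (lam0 - q) + D) q1.
  by rewrite addr_ge0 ?(ltW D0) // divr_ge0 // ltW.
exists D, (maxn K 2); split=> // k; rewrite geq_max => /andP[Kk k1] w1 w2 _ _ lam1 spec1.
have qk0 : 0 < q ^+ k by rewrite exprn_gt0.
have [qk_gap qk_D] : D / q ^+ k < lam0 - q /\ D / q ^+ k < 1.
  have D_lt := ltK k Kk.
  rewrite !ltr_pdivrMr // mul1r mulrC -ltr_pdivrMr //; split.
    by apply: le_lt_trans D_lt; rewrite lerDl ltW.
  by apply: le_lt_trans D_lt; rewrite lerDr divr_ge0 // ltW.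
pose mu := lam0 - D / q ^+ k.
have q_mu : q <= mu by rewrite lerBrDr addrC -lerBrDr ltW.
have mu0 : 0 < mu by apply: lt_le_trans q_mu.
have cost_le : 2 * (M / mu ^+ k) <= D / q ^+ k * m.
  rewrite mulrAC Dm mulrA ler_pM2l ?mulr_gt0 ?ltr0n //.
  by rewrite lef_pV2 ?posrE ?exprn_gt0 // lerXn2r ?nnegrE ?(ltW q0) ?(ltW mu0).
have mle x : m <= v 0 x by have := mv x; rewrite mulr1.
have mu_lam1 : mu <= lam1.
  (* Any letter would serve as starting point; [thead w1] is one at hand. *)
  apply: (@Tk_forbid_spectral_radius_ge r T lam0 M mu v k [:: tval w1; tval w2]
    T01 vT vM (ltW M0) mu0 _ _ (thead w1) lam1 k1 _ spec1).
  - by move=> w; rewrite !inE => /orP[] /eqP->; rewrite size_tuple.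
  - move=> x; apply: le_trans cost_le _; rewrite opprB addrC subrK.
    by rewrite ler_wpM2l // divr_ge0 // ltW.
  - apply: le_lt_trans cost_le _; apply: lt_le_trans (mle _).
    by rewrite gtr_pMl.
have lam1_le : lam1 <= lam0.
  case: spec1 => -[z eig_z <-] _.
  exact: Tk_forbid_eigenvalue_le T01 vT v0 k1 eig_z.
rewrite distrC ger0_norm ?subr_ge0 // lerBlDr addrC -lerBlDr.
exact: mu_lam1.
Qed.
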